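(* Let $n\ge1$. For each $\alpha\in\mathbb{R}$ with $\alpha\neq 0$, there is a generic subset $\mathcal{M}$ of $\mathcal{S}^{II}_n$ such that, for every pair of systems $\sigma_1,\sigma_2\in\mathcal{M}$: $\sigma_1$ and $\sigma_2$ are i/o equivalent with respect to all inputs in $\mathcal{V}_\alpha$ if and only if $\sigma_1$ and $\sigma_2$ are i/o equivalent.
   Context: A 4-tuple of dimension $n$ is $(A,N,b,c)$ with $A,N\in\mathbb{R}^{n\times n}$, $b\in\mathbb{R}^{n\times 1}$, $c\in\mathbb{R}^{1\times n}$. The bilinear system of type II associated with it is $\dot x=(A+uN)x$, $x(0)=b$, $y=cx$. The class $\mathcal{S}^{II}_n$ of all $n$-dimensional bilinear systems of type II is identified with $\mathbb{R}^{2n^2+2n}$ via 4-tuples. A subset of $\mathbb{R}^\ell$ is called generic if it is open and dense and its complement has Lebesgue measure zero. Inputs are Lebesgue-measurable, essentially bounded functions $u:[0,T_u]\to\mathbb{R}$; $\Omega$ is the set of all inputs. Two systems are i/o equivalent with respect to a set $\mathcal{U}\subseteq\Omega$ of inputs if for each $u\in\mathcal{U}$ the two outputs $y(t)$ coincide for all $t\in[0,T_u]$; they are i/o equivalent (no qualifier) if this holds with $\mathcal{U}=\Omega$. The pulse is $\mathbf{u}_{\tau,\alpha}(t)=\alpha$ for $0\le t<\tau$ and $\mathbf{u}_{\tau,\alpha}(t)=0$ for $t\ge\tau$, and $\mathcal{V}_\alpha=\{\mathbf{u}_{\tau,\alpha}\mid \tau\ge0\}$. Pulses may be viewed as defined on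 $[0,T]$ for any $T>\tau$; the choice of $T$ is immaterial, so equivalence under a pulse means that outputs coincide for all $t\ge 0$. *)

(* Defs.v *)
From HB Require Import structures.
From mathcomp Require Import all_boot all_order all_algebra.
From mathcomp Require Import all_classical all_reals all_analysis.
From mathcomp Require Import measurable_realfun.

Set Implicit Arguments.
Unset Strict Implicit.
Unset Printing Implicit Defensive.

Import Order.TTheory GRing.Theory Num.Theory.
Import numFieldNormedType.Exports.

Local Open Scope classical_set_scope.
Local Open Scope ring_scope.

Fixpoint lebesgue_tuple (R : realType) (l : nat) :
    set (l.-tuple (measurableTypeR R)) -> \bar R :=
  match l with
  | 0 => \d_([tuple] : 0.-tuple (measurableTypeR R))
  | k.+1 => pushforward (@lebesgue_measure R \x @lebesgue_tuple R k)%E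
              (fun p => [tuple of p.1 :: p.2])
  end.

Lemma lebesgue_tuple0 (R : realType) (l : nat) : @lebesgue_tuple R l set0 = 0%E.
Proof.
elim: l => [|l IH] /=; first by rewrite diracE in_set0.
rewrite /pushforward preimage_set0 /product_measure1 integral0_eq// => x _ /=.
by rewrite xsection0.
Qed.

(* Only the values on Borel sets are used below, and there they are determined
   by the values on boxes. *)
Lemma lebesgue_tuple_box (R : realType) (l : nat) (a b : 'I_l -> R) :
  (forall i, a i <= b i) ->
  @lebesgue_tuple R l [set t | forall i, a i <= tnth t i <= b i] =
  (\prod_(i < l) (b i - a i))%:E.
Proof.
elim: l a b => [|l IH] a b ab.
  by rewrite /= big_ord0 diracE mem_set// => -[].
rewrite /= /pushforward /product_measure1 big_ord_recl.
pose c := \prod_(i < l) (b (lift ord0 i) - a (lift ord0 i)).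
have c0 : 0 <= c by apply: prodr_ge0 => i _; rewrite subr_ge0.
under eq_integral => x _.
  rewrite (_ : _ x = (c%:E * (\1_`[a ord0, b ord0] x)%:E)%E); first over.
  rewrite -IH; last by move=> i; exact: ab.
  rewrite /= indicE; case: (boolP (x \in _)) => [xin|xin].
    rewrite mule1; congr (lebesgue_tuple _); apply/seteqP; split => t /=.
      rewrite /xsection /= inE /= => h i.
      by have := h (lift ord0 i); rewrite tnthS.
    rewrite /xsection /= inE /= => h i.
    have [j ->|->] := unliftP ord0 i; first by rewrite tnthS.
    by rewrite tnth0; move: xin; rewrite inE /= in_itv.
  rewrite mule0 (_ : xsection _ _ = set0) ?lebesgue_tuple0//.
  apply/seteqP; split => t //=; rewrite /xsection /= inE /= => /(_ ord0).
  by rewrite tnth0 => h; move: xin; rewrite notin_setE /= in_itv/= h.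
rewrite /= ge0_integralZl//=; last exact/measurable_EFinP/measurable_indic.
rewrite integral_indic// setIT/= lebesgue_measure_itv/= lte_fin muleC EFinM.
by have := ab ord0; rewrite le_eqVlt => /orP[/eqP->|->];
   rewrite ?ltxx ?subrr// EFinB.
Qed.

Definition lebesgue_null (R : realType) (l : nat) (E : set 'rV[R]_l) : Prop :=
  (@lebesgue_tuple R l).-negligible ((fun v => [tuple v 0 i | i < l]) @` E).

Definition generic (R : realType) (l : nat) (E : set 'rV[R]_l) : Prop :=
  [/\ open E, dense E & lebesgue_null (~` E)].

Record bilinear_system (R : realType) (n : nat) := BilinearSystem {
  sysA : 'M[R]_n;
  sysN : 'M[R]_n;
  sysb : 'cV[R]_n;
  sysc : 'rV[R]_n
}.

(* The identification of the class of n-dimensional systems with R^(2n^2+2n). *)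
Definition coordinates (R : realType) (n : nat) (s : bilinear_system R n) :
    'rV[R]_(n * n + n * n + n + n) :=
  row_mx (row_mx (row_mx (mxvec (sysA s)) (mxvec (sysN s))) (sysb s)^T) (sysc s).

Definition generic_systems (R : realType) (n : nat)
    (M : set (bilinear_system R n)) : Prop :=
  generic ((@coordinates R n) @` M).

(* Only the values of [signal] on [0, horizon] are meaningful. *)
Record input (R : realType) := Input { horizon : R; signal : R -> R }.

(* [completed_lebesgue_measure] lives on the Lebesgue sigma-algebra, whereas
   [lebesgue_measure] only lives on the Borel one. *)
Definition admissible (R : realType) : set (input R) :=
  [set u | [/\ 0 <= horizon u,
    measurable_fun (`[0, horizon u]%classic :
        set (caratheodory_type (wlength (@idfun R))^*%mu)) (signal u) &
    exists K : R, {ae @completed_lebesgue_measure R,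
      forall t, 0 <= t <= horizon u -> `|signal u t| <= K}]].

(* Solution on [0, horizon u] in the sense of Caratheodory of
   x' = (A + u N) x, x(0) = b. *)
Definition is_trajectory (R : realType) (n : nat) (s : bilinear_system R n)
    (u : input R) (x : R -> 'cV[R]_n) : Prop :=
  {within `[0, horizon u], continuous x} /\
  forall t, 0 <= t <= horizon u -> forall i : 'I_n,
    x t i 0 = sysb s i 0 +
      \int[@completed_lebesgue_measure R]_(r in `[0, t])
        (((sysA s + signal u r *: sysN s) *m x r) i 0).

Definition is_output (R : realType) (n : nat) (s : bilinear_system R n)
    (u : input R) (y : R -> R) : Prop :=
  exists2 x, is_trajectory s u x & forall t, y t = (sysc s *m x t) 0 0.

(* For an admissible input the trajectory exists and is unique on
   [0, horizon u], so that the two outputs are well defined there. *)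
Definition io_equivalent_wrt (R : realType) (n : nat) (U : set (input R))
    (s1 s2 : bilinear_system R n) : Prop :=
  forall u, U u -> forall y1 y2, is_output s1 u y1 -> is_output s2 u y2 ->
    forall t, 0 <= t <= horizon u -> y1 t = y2 t.

Definition io_equivalent (R : realType) (n : nat)
    (s1 s2 : bilinear_system R n) : Prop :=
  io_equivalent_wrt (@admissible R) s1 s2.

Definition pulse (R : realType) (tau alpha : R) : R -> R :=
  fun t => if 0 <= t < tau then alpha else 0.

(* Each pulse is taken on every [0, T] with T > tau, so that equivalence under
   the pulse is equality of the outputs at all t >= 0. *)
Definition pulses (R : realType) (alpha : R) : set (input R) :=
  [set u | exists tau T : R,
     [/\ 0 <= tau, tau < T & u = Input T (pulse tau alpha)]].

(* Main.v *)
Require Import Defs.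
From mathcomp Require Import all_boot all_order all_algebra.
From mathcomp Require Import all_classical all_reals all_analysis.
From mathcomp Require Import measurable_realfun.
From mathcomp Require Import ring lra.

Set Implicit Arguments.
Unset Strict Implicit.
Unset Printing Implicit Defensive.

Import Order.TTheory GRing.Theory Num.Theory.
Import numFieldNormedType.Exports.

Local Open Scope classical_set_scope.
Local Open Scope ring_scope.

(** Write [A] for the drift matrix of a system and [B = A + alpha N] for its
    dynamics while a pulse of height [alpha] is on.  A pulse of length [tau]
    observed for a further time [t] yields the output [c e^(tA) e^(tau B) b], so
    that equality of all pulse responses amounts to equality of all the numbers
    [c A^i B^j b] ([pulse_parameter_eq]).

    Generically [A] is observable through [c] and [b] is reachable for [B], that
    is, the matrices [O] with rows [c A^i] and [C] with columns [B^j b] are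
    invertible.  For two such systems the numbers above give [O1 C1 = O2 C2],
    [O1 A1 C1 = O2 A2 C2] and [O1 B1 C1 = O2 B2 C2], and [T = O2^-1 O1] is a change
    of coordinates that takes the first quadruple [(A, B, b, c)] to the second;
    since [alpha] is nonzero it also intertwines the matrices [N]
    ([pulse_parameter_similar]).

    Similar systems have equal outputs under every admissible input, since [T]
    maps trajectories of the first to trajectories of the second and
    trajectories are unique by Gronwall's inequality ([similar_io_equivalent]).
    The converse implication of the theorem holds because pulses are admissible.

    The class is the nonvanishing locus of a polynomial in the coordinates of
    the system.  Such a locus is generic as soon as it is nonempty
    ([generic_polyfun]): along every line a polynomial has finitely many zeros,
    which gives density, and by Fubini its zero set is null.

    Equivalence compares all existing outputs, so information is extracted from
    a pulse only by exhibiting a trajectory.  The solution of [x' = A x] is built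
    coordinatewise as a power series with coefficients [a_k / k!], where
    [a_k = (A^k v)_i] grows at most geometrically; differentiation shifts the
    sequence [a], and the series determines [a]. *)

(** * Zero sets of polynomial functions *)

(** Polynomial functions of finitely many real variables, generated from
    constants and coordinates.  Arguments are plain functions on ['I_l], so that
    the same predicate applies to tuples (on which the measure lives) and to row
    vectors (on which the topology lives). *)
Inductive polyfun (R : realType) (l : nat) : (('I_l -> R) -> R) -> Prop :=
| polyfun_cst c : polyfun (fun=> c)
| polyfun_coord i : polyfun (fun x => x i)
| polyfunD f g of polyfun f & polyfun g : polyfun (fun x => f x + g x)
| polyfunM f g of polyfun f & polyfun g : polyfun (fun x => f x * g x).

Section polyfun_theory.
Context {R : realType} {l : nat}.
Implicit Type f : ('I_l -> R) -> R.

Lemma polyfun_line f (v w : 'I_l -> R) : polyfun f ->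
  exists p : {poly R}, forall t, f (fun i => v i + t * w i) = p.[t].
Proof.
elim=> [c|i|g h _ [p gp] _ [q hq]|g h _ [p gp] _ [q hq]].
- by exists c%:P => t; rewrite hornerC.
- by exists ((v i)%:P + 'X * (w i)%:P) => t; rewrite !hornerE.
- by exists (p + q) => t; rewrite hornerD gp hq.
- by exists (p * q) => t; rewrite hornerM gp hq.
Qed.

Lemma continuous_polyfun f : polyfun f ->
  continuous (fun v : 'rV[R]_l => f (v 0)).
Proof.
elim=> [c|i|g h _ cg _ ch|g h _ cg _ ch] v /=.
- exact: cst_continuous.
- exact: coord_continuous.
- exact: cvgD (cg v) (ch v).
- exact: cvgM (cg v) (ch v).
Qed.

Lemma measurable_polyfun f : polyfun f ->
  measurable_fun setT (fun t : l.-tuple (measurableTypeR R) => f (tnth t)).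
Proof.
elim=> [c|i|g h _ mg _ mh|g h _ mg _ mh].
- exact: measurable_cst.
- exact: measurable_tnth.
- exact: measurable_funD.
- exact: measurable_funM.
Qed.

End polyfun_theory.

Definition cons_fun (T : Type) (k : nat) (a : T) (x : 'I_k -> T) (i : 'I_k.+1) : T :=
  if unlift ord0 i is Some j then x j else a.

Lemma polyfun_cons (R : realType) (k : nat) (f : ('I_k.+1 -> R) -> R) a :
  polyfun f -> polyfun (fun x => f (cons_fun a x)).
Proof.
elim=> [c|i|g h _ pg _ ph|g h _ pg _ ph]; try by constructor.
by rewrite /cons_fun; case: (unlift ord0 i) => [j|]; constructor.
Qed.

Lemma tnth_cons_fun (R : Type) (k : nat) (a : R) (t : k.-tuple R) :
  tnth [tuple of a :: t] = cons_fun a (tnth t).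
Proof.
apply/funext => i; rewrite /cons_fun; case: unliftP => [j ->|->].
  by rewrite tnthS.
by rewrite tnth0.
Qed.

Lemma countable_root (R : realType) (p : {poly R}) :
  p != 0 -> countable [set x | root p x].
Proof.
move=> p0; apply: finite_set_countable; apply: contrapT => /infinite_set_fset.
move=> /(_ (size p)) [B Bp]; apply/negP; rewrite -ltnNge.
apply: max_poly_roots => //; last exact: finmap.fset_uniq.
by apply/allP => x xB; exact: (Bp x).
Qed.

Lemma lebesgue_tuple_ge0 (R : realType) (l : nat) E :
  (0 <= @lebesgue_tuple R l E)%E.
Proof.
elim: l E => [|l IH] E /=; first by rewrite diracE lee_fin.
by apply: integral_ge0 => x _; exact: IH.
Qed.

(** A countable set is null and all its subsets are Borel, so that [h] is Borel
    and almost everywhere [0]. *)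
Lemma integral_countable_support (R : realType) (h : R -> \bar R) (N : set R) :
  countable N -> (forall x, 0 <= h x)%E -> (forall x, ~ N x -> h x = 0%E) ->
  (\int[@lebesgue_measure R]_x h x)%E = 0%E.
Proof.
move=> cN h0 hN.
have mN (A : set R) : A `<=` N -> measurable (A : set (measurableTypeR R)).
  move=> AN; apply: countable_measurable; first exact: measurable_set1.
  exact: sub_countable (subset_card_le AN) cN.
rewrite -(integral0 (@lebesgue_measure R) setT).
apply: ge0_ae_eq_integral => //; last first.
  exists N; split; [exact: mN|exact: countable_lebesgue_measure0|].
  by move=> x /= nhx; apply: contrapT => Nx; apply: nhx => _; rewrite hN.
move=> _ B mB; rewrite setTI.
have [B0|B0] := pselect (B 0%E); last first.
  by apply: mN => x /= Bhx; apply: contrapT => /hN h0x; apply: B0; rewrite -h0x.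
rewrite -(setCK (h @^-1` B)); apply: measurableC; apply: mN => x /= Bhx.
by apply: contrapT => /hN h0x; apply: Bhx; rewrite h0x.
Qed.

(** By Fubini along the first variable: if [f] does not vanish at [x], then
    [f (a, x_1, ...)] is a nonzero polynomial in [a], so that for all but finitely
    many [a] the section of [f] at [a] is again a nonzero polynomial function. *)
Lemma lebesgue_tuple_zeros (R : realType) (l : nat) (f : ('I_l -> R) -> R)
    (x : 'I_l -> R) :
  polyfun f -> f x != 0 ->
  @lebesgue_tuple R l [set t | f (tnth t) = 0] = 0%E.
Proof.
elim: l f x => [|k IH] f x pf fx /=.
  rewrite diracE memNset//= => fx0; move/eqP: fx; apply.
  by rewrite -fx0; congr f; apply/funext; case.
pose x' j := x (lift ord0 j).
have [p fp] : exists p : {poly R}, forall a, f (cons_fun a x') = p.[a].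
  have [p fp] := polyfun_line (cons_fun 0 x') (cons_fun 1 (fun=> 0)) pf.
  exists p => a; rewrite -fp; congr f; apply/funext => i; rewrite /cons_fun.
  by case: unliftP => [j _|_]; rewrite ?mulr0 ?addr0 ?mulr1 ?add0r.
have xE : cons_fun (x ord0) x' = x.
  by apply/funext => i; rewrite /cons_fun; case: unliftP => [j ->|->].
have p0 : p != 0.
  by apply: contra_neq fx => p0; rewrite -xE fp p0 horner0.
apply: (integral_countable_support (countable_root p0)) => [a|a pa] /=.
  exact: lebesgue_tuple_ge0.
have fa : f (cons_fun a x') != 0 by rewrite fp; exact/negP.
rewrite -(IH _ x' (polyfun_cons a pf) fa).
congr lebesgue_tuple; apply/seteqP; split => t;
  by rewrite /xsection /= inE /= tnth_cons_fun.
Qed.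

(** Density holds since a polynomial restricted to the line from any point to
    [x] has finitely many zeros. *)
Lemma generic_polyfun (R : realType) (l : nat) (f : ('I_l -> R) -> R)
    (x : 'I_l -> R) : polyfun f -> f x != 0 ->
  generic [set v : 'rV[R]_l | f (v 0) != 0].
Proof.
move=> pf fx; have cf := continuous_polyfun pf; split.
- rewrite (_ : mkset _ = (fun v : 'rV[R]_l => f (v 0)) @^-1` [set r | r != 0]).
    by apply: open_comp => [v _|]; [exact: cf|exact: open_neq].
  by [].
- move=> O [v Ov] openO.
  pose w i := x i - v 0 i.
  have [p fp] := polyfun_line (v 0) w pf.
  have p0 : p != 0.
    apply: contra_neq fx => p0; have := fp 1; rewrite p0 horner0 => <-.
    by congr f; apply/funext => i; rewrite /w mul1r addrC subrK.
  pose g t := v + t *: (\row_i w i).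
  have cg : g t @[t --> (0 : R)] --> v.
    rewrite -[X in _ --> X]addr0 -[X in _ + X](scale0r (\row_i w i)).
    by apply: cvgD; [exact: cvg_cst|apply: cvgZr_tmp; exact: cvg_id].
  have /nbhs_ballP[e /= e0 eO] := cg _ (open_nbhs_nbhs (conj openO Ov)).
  have [t te pt] : exists2 t, ball (0 : R) e t & ~ root p t.
    apply: contrapT => noroot.
    have /countable_lebesgue_measure0/eqP : countable (ball (0 : R) e).
      apply: sub_countable (countable_root p0); apply: subset_card_le => t et.
      by apply: contrapT => npt; apply: noroot; exists t.
    by rewrite lebesgue_measure_ball ?ltW// eqe mulrn_eq0/= gt_eqF.
  exists (g t); split; first exact: eO.
  apply/eqP => gt0; apply: pt; apply/eqP; rewrite -fp -gt0 /=; congr f.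
  by apply/funext => i; rewrite !mxE.
- exists [set t : l.-tuple (measurableTypeR R) | f (tnth t) = 0]; split.
  + have := measurable_polyfun pf measurableT (measurable_set1 (0 : R)).
    by rewrite setTI.
  + exact: lebesgue_tuple_zeros pf fx.
  + move=> _ [v /= /negP/negPn/eqP fv <-] /=; rewrite -fv; congr f.
    by apply/funext => i; rewrite tnth_mktuple.
Qed.

(** * Systems in the generic class *)

Section generic_class.
Context {R : realType} {n : nat}.
Implicit Types (alpha : R) (s : bilinear_system R n).

(** The matrix of the dynamics while the pulse is on. *)
Definition sys_on alpha s : 'M[R]_n := sysA s + alpha *: sysN s.

Definition observability s : 'M[R]_n :=
  \matrix_(i, j) (sysc s *m sysA s ^+ i) 0 j.

Definition reachability alpha s : 'M[R]_n :=
  \matrix_(i, j) (sys_on alpha s ^+ j *m sysb s) i 0.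

(** Nonvanishing of this one polynomial says at once that the off dynamics is
    observable through [sysc] and that [sysb] is reachable for the on dynamics. *)
Definition generic_class alpha : set (bilinear_system R n) :=
  [set s | \det (observability s) * \det (reachability alpha s) != 0].

Definition sys_polyfun (g : bilinear_system R n -> R) :=
  exists2 f, polyfun f & forall s, g s = f (coordinates s 0).

Definition sys_polymx p q (F : bilinear_system R n -> 'M[R]_(p, q)) :=
  forall i j, sys_polyfun (fun s => F s i j).

Lemma sys_polyfun_cst c : sys_polyfun (fun=> c).
Proof. by exists (fun=> c) => //; exact: polyfun_cst. Qed.

Lemma sys_polyfunD g h :
  sys_polyfun g -> sys_polyfun h -> sys_polyfun (fun s => g s + h s).
Proof.
move=> [f pf gf] [k pk hk]; exists (fun x => f x + k x).
  exact: polyfunD.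
by move=> s; rewrite gf hk.
Qed.

Lemma sys_polyfunM g h :
  sys_polyfun g -> sys_polyfun h -> sys_polyfun (fun s => g s * h s).
Proof.
move=> [f pf gf] [k pk hk]; exists (fun x => f x * k x).
  exact: polyfunM.
by move=> s; rewrite gf hk.
Qed.

Lemma sys_polyfun_sum (I : Type) (r : seq I) g :
  (forall i, sys_polyfun (g i)) -> sys_polyfun (fun s => \sum_(i <- r) g i s).
Proof.
move=> pg; elim: r => [|i r IH].
  by under eq_fun do rewrite big_nil; exact: sys_polyfun_cst.
by under eq_fun do rewrite big_cons; exact: sys_polyfunD.
Qed.

Lemma sys_polyfun_prod (I : Type) (r : seq I) g :
  (forall i, sys_polyfun (g i)) -> sys_polyfun (fun s => \prod_(i <- r) g i s).
Proof.
move=> pg; elim: r => [|i r IH].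
  by under eq_fun do rewrite big_nil; exact: sys_polyfun_cst.
by under eq_fun do rewrite big_cons; exact: sys_polyfunM.
Qed.

Lemma sys_polymxA : sys_polymx (@sysA R n).
Proof.
move=> i j.
exists (fun x => x (lshift n (lshift n (lshift _ (mxvec_index i j))))).
  exact: polyfun_coord.
by move=> s; rewrite /coordinates !row_mxEl mxvecE.
Qed.

Lemma sys_polymxN : sys_polymx (@sysN R n).
Proof.
move=> i j.
exists (fun x => x (lshift n (lshift n (rshift _ (mxvec_index i j))))).
  exact: polyfun_coord.
by move=> s; rewrite /coordinates !row_mxEl row_mxEr mxvecE.
Qed.

Lemma sys_polymxb : sys_polymx (@sysb R n).
Proof.
move=> i j; exists (fun x => x (lshift n (rshift _ i))).
  exact: polyfun_coord.
by move=> s; rewrite /coordinates row_mxEl row_mxEr mxE (ord1 j).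
Qed.

Lemma sys_polymxc : sys_polymx (@sysc R n).
Proof.
move=> i j; exists (fun x => x (rshift _ j)); first exact: polyfun_coord.
by move=> s; rewrite /coordinates row_mxEr (ord1 i).
Qed.

Lemma sys_polymxM p q r (F : _ -> 'M[R]_(p, q)) (G : _ -> 'M[R]_(q, r)) :
  sys_polymx F -> sys_polymx G -> sys_polymx (fun s => F s *m G s).
Proof.
move=> pF pG i j; under eq_fun do rewrite mxE.
by apply: sys_polyfun_sum => k; exact: sys_polyfunM.
Qed.

Lemma sys_polymxX (F : _ -> 'M[R]_n) k :
  sys_polymx F -> sys_polymx (fun s => F s ^+ k).
Proof.
move=> pF; elim: k => [|k IH].
  by move=> i j; under eq_fun do rewrite expr0; exact: sys_polyfun_cst.
by under eq_fun do rewrite exprS; exact: sys_polymxM.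
Qed.

Lemma sys_polyfun_det (F : _ -> 'M[R]_n) :
  sys_polymx F -> sys_polyfun (fun s => \det (F s)).
Proof.
move=> pF; apply: sys_polyfun_sum => u; apply: sys_polyfunM.
  exact: sys_polyfun_cst.
by apply: sys_polyfun_prod => i; exact: pF.
Qed.

Lemma sys_polyfun_generic_class alpha :
  sys_polyfun (fun s => \det (observability s) * \det (reachability alpha s)).
Proof.
apply: sys_polyfunM; apply: sys_polyfun_det => i j; under eq_fun do rewrite mxE.
  exact: (sys_polymxM sys_polymxc (sys_polymxX i sys_polymxA)).
have pon : sys_polymx (sys_on alpha).
  move=> k l; rewrite /sys_on; under eq_fun do rewrite 2!mxE.
  apply: sys_polyfunD; first exact: sys_polymxA.
  by apply: sys_polyfunM; [exact: sys_polyfun_cst|exact: sys_polymxN].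
exact: (sys_polymxM (sys_polymxX j pon) sys_polymxb).
Qed.

(** Both determinants are [1] when the off dynamics is the nilpotent shift [A],
    the on dynamics its transpose, and [sysc] and [sysb] are the first basis
    vectors: then [c A^k] and [(A^T)^k b] run through the standard basis.
    Dividing by [alpha] solves for [sysN]. *)
Lemma generic_class_neq0 alpha :
  (0 < n)%N -> alpha != 0 -> exists s, generic_class alpha s.
Proof.
move=> n_gt0 alpha0.
pose A : 'M[R]_n := \matrix_(i, j) (i.+1 == j)%:R.
pose c : 'rV[R]_n := \row_j (j == 0 :> nat)%:R.
have cA k : c *m A ^+ k = \row_j (k == j)%:R.
  elim: k => [|k IH].
    by rewrite expr0 mulmx1; apply/rowP => j; rewrite !mxE eq_sym.
  rewrite exprSr mulmxA IH; apply/rowP => j; rewrite !mxE.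
  have [kn|kn] := ltnP k n.
    rewrite (bigD1 (Ordinal kn))//= !mxE eqxx mul1r big1 ?addr0//.
    move=> i /eqP ik; rewrite !mxE (_ : (k == i) = false) ?mul0r//.
    by apply/eqP => ki; apply: ik; apply/val_inj.
  rewrite big1 => [|i _].
    by rewrite gtn_eqF// ltnS (leq_trans (ltnW (ltn_ord j))).
  by rewrite !mxE gtn_eqF ?mul0r// (leq_trans (ltn_ord i)).
exists (BilinearSystem A (alpha^-1 *: (A^T - A)) c^T c).
rewrite /generic_class /=.
set s := BilinearSystem _ _ _ _.
have -> : observability s = 1%:M.
  by apply/matrixP => i j; rewrite mxE /= cA !mxE.
have -> : reachability alpha s = 1%:M.
  apply/matrixP => i j; rewrite mxE /sys_on /= scalerA divff// scale1r addrC subrK.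
  have -> : A^T ^+ j *m c^T = (c *m A ^+ j)^T.
    rewrite trmx_mul; congr (_ *m _).
    by elim: (val j) => [|k IH]; rewrite ?expr0 ?trmx1// exprS exprSr trmx_mul IH.
  by rewrite cA !mxE eq_sym.
by rewrite det1 mulr1 oner_neq0.
Qed.

Lemma generic_generic_class alpha :
  (0 < n)%N -> alpha != 0 -> generic_systems (generic_class alpha).
Proof.
move=> n_gt0 alpha0; have [f pf gf] := sys_polyfun_generic_class alpha.
have [s0 s0P] := generic_class_neq0 n_gt0 alpha0.
suff : @coordinates R n @` generic_class alpha = [set v | f (v 0) != 0].
  rewrite /generic_systems => ->.
  by apply: (@generic_polyfun R _ f (coordinates s0 0) pf); rewrite -gf.
apply/seteqP; split => [_ [s sP <-]|v fv] /=; first by rewrite -gf.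
pose s := BilinearSystem (vec_mx (lsubmx (lsubmx (lsubmx v))))
  (vec_mx (rsubmx (lsubmx (lsubmx v)))) (rsubmx (lsubmx v))^T (rsubmx v).
have sE : coordinates s = v by rewrite /coordinates /= !vec_mxK trmxK !hsubmxK.
by exists s => //; rewrite /generic_class /= gf sE.
Qed.

Definition similar_systems s1 s2 := exists T : 'M[R]_n,
  [/\ T *m sysA s1 = sysA s2 *m T, T *m sysN s1 = sysN s2 *m T,
      T *m sysb s1 = sysb s2 & sysc s1 = sysc s2 *m T].

(** The coefficient of [t^i tau^j / (i! j!)] in the output at time [tau + t] of
    the response to the pulse of length [tau]. *)
Definition pulse_parameter alpha s (i j : nat) : R :=
  (sysc s *m sysA s ^+ i *m (sys_on alpha s ^+ j *m sysb s)) 0 0.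

Lemma mul_observability s (v : 'cV[R]_n) i :
  (observability s *m v) i 0 = (sysc s *m sysA s ^+ i *m v) 0 0.
Proof. by rewrite !mxE; apply: eq_bigr => k _; rewrite mxE. Qed.

Lemma mul_reachability alpha s (w : 'rV[R]_n) j :
  (w *m reachability alpha s) 0 j = (w *m (sys_on alpha s ^+ j *m sysb s)) 0 0.
Proof.
rewrite [LHS]mxE [RHS]mxE; apply: eq_bigr => k _.
by rewrite [reachability _ _ _ _]mxE.
Qed.

Lemma observability_reachability alpha s (X : 'M[R]_n) i j :
  (observability s *m X *m reachability alpha s) i j =
  (sysc s *m sysA s ^+ i *m X *m (sys_on alpha s ^+ j *m sysb s)) 0 0.
Proof.
rewrite -mul_reachability.
have -> : sysc s *m sysA s ^+ i = row i (observability s).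
  by apply/rowP => k; rewrite !mxE.
by rewrite -!row_mul [RHS]mxE.
Qed.

(** A realization argument with Hankel matrices.  The parameters are the entries
    of [O C], where [O] is the observability matrix of the off dynamics [A] and
    [C] the reachability matrix of the on dynamics [B]; shifting [i] or [j] gives
    [O A C] and [O B C].  As [O] and [C] are invertible these determine the
    system up to the change of coordinates [T], with [O1 = O2 T] and
    [T C1 = C2]. *)
Lemma pulse_parameter_similar alpha s1 s2 : alpha != 0 ->
  generic_class alpha s1 -> generic_class alpha s2 ->
  pulse_parameter alpha s1 =2 pulse_parameter alpha s2 -> similar_systems s1 s2.
Proof.
move=> alpha0; rewrite /generic_class /=.
rewrite !mulf_eq0 !negb_or -!unitfE -!unitmxE => /andP[uO1 uC1] /andP[uO2 uC2].
move=> par.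
set O1 := observability s1 in uO1 *; set O2 := observability s2 in uO2 *.
set C1 := reachability alpha s1 in uC1 *; set C2 := reachability alpha s2 in uC2 *.
pose T := invmx O2 *m O1.
have OTE : O1 = O2 *m T by rewrite mulmxA mulmxV// mul1mx.
have cancelO p (X Y : 'M[R]_(n, p)) : O1 *m X = O2 *m Y -> T *m X = Y.
  by move=> XY; rewrite -mulmxA XY mulmxA mulVmx// mul1mx.
have TC : T *m C1 = C2.
  apply: cancelO; apply/matrixP => i j.
  rewrite -(mulmx1 O1) -(mulmx1 O2) !observability_reachability !mulmx1.
  exact: par.
have intertwine X1 X2 : O1 *m X1 *m C1 = O2 *m X2 *m C2 -> T *m X1 = X2 *m T.
  rewrite -!mulmxA => /cancelO; rewrite -TC !mulmxA.
  by move/(congr1 (mulmx^~ (invmx C1))); rewrite -!mulmxA mulmxV// !mulmx1.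
have TA : T *m sysA s1 = sysA s2 *m T.
  apply: intertwine; apply/matrixP => i j; rewrite !observability_reachability.
  by have := par i.+1 j; rewrite /pulse_parameter !exprSr !mulmxA.
have TB : T *m sys_on alpha s1 = sys_on alpha s2 *m T.
  apply: intertwine; apply/matrixP => i j; rewrite !observability_reachability.
  by have := par i j.+1; rewrite /pulse_parameter !exprS !mulmxA.
exists T; split => //.
- move: TB; rewrite /sys_on mulmxDr mulmxDl TA => /addrI.
  by rewrite -scalemxAl -scalemxAr => /(scalerI alpha0).
- apply: cancelO; apply/colP => i; rewrite !mul_observability.
  by have := par i 0; rewrite /pulse_parameter !expr0 !mul1mx.
- have : sysc s1 *m C1 = sysc s2 *m C2.
    apply/rowP => j; rewrite !mul_reachability.
    by have := par 0 j; rewrite /pulse_parameter !expr0 !mulmx1.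
  rewrite -TC mulmxA => /(congr1 (mulmx^~ (invmx C1))).
  by rewrite -!mulmxA mulmxV// !mulmx1.
Qed.

End generic_class.

(** * Exponential generating functions and linear differential equations *)

Section egf.
Context {R : realType}.
Implicit Types (a b : R^nat) (t : R).

Definition egf a t : R := limn (pseries (fun k => a k / k`!%:R) t).

Definition geometric_growth a := exists M q, forall k, `|a k| <= M * q ^+ k.

Lemma is_cvg_egf a t :
  geometric_growth a -> cvgn (pseries (fun k => a k / k`!%:R) t).
Proof.
move=> [M [q aMq]]; apply: normed_cvg.
have M0 : 0 <= M by have := aMq 0%N; rewrite expr0 mulr1; exact: le_trans.
apply: (@series_le_cvg R _ (fun k => M * exp_coeff `|q * t| k)) => [k|k|k|].
- exact: normr_ge0.
- by apply: mulr_ge0 => //; rewrite /exp_coeff/= divr_ge0// exprn_ge0.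
- rewrite /exp_coeff /= !normrM normfV normr_nat !normrX mulrAC mulrA.
  rewrite ler_wpM2r ?invr_ge0// exprMn mulrA ler_wpM2r ?exprn_ge0//.
  by rewrite (le_trans (aMq k))// ler_wpM2l// -normrX ler_norm.
- by have := @is_cvg_seriesZ R (exp_coeff `|q * t|) M (@is_cvg_series_exp_coeff _ _).
Qed.

Lemma geometric_growthS a :
  geometric_growth a -> geometric_growth (fun k => a k.+1).
Proof.
by move=> [M [q aMq]]; exists (M * q), q => k; rewrite -mulrA -exprS.
Qed.

Lemma is_derive_egf a t : geometric_growth a ->
  is_derive t 1 (egf a) (egf (fun k => a k.+1) t).
Proof.
move=> ga.
have dE (c : R^nat) :
    pseries_diffs (fun k => c k / k`!%:R) = fun k => c k.+1 / k`!%:R.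
  apply/funext => k; rewrite /pseries_diffs factS natrM invfM.
  by rewrite mulrCA mulVKf ?pnatr_eq0.
have := @pseries_snd_diffs R (fun k => a k / k`!%:R) (`|t| + 1) t.
rewrite !dE; apply.
- exact: is_cvg_egf.
- exact: is_cvg_egf (geometric_growthS ga).
- exact: is_cvg_egf (geometric_growthS (geometric_growthS ga)).
- by rewrite [X in _ < X]ger0_norm ?addr_ge0// ltrDl.
Qed.

Lemma continuous_egf a : geometric_growth a -> continuous (egf a).
Proof.
move=> ga t; apply: differentiable_continuous; apply/derivable1_diffP.
by have [] := is_derive_egf t ga.
Qed.

Lemma egf0 a : egf a 0 = a 0%N.
Proof.
apply: cvg_lim => //; rewrite -cvg_shiftS; apply: cvg_near_cst.
apply: nearW => k; rewrite /pseries/= /series/= big_nat_recl// expr0 mulr1.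
by rewrite fact0 invr1 mulr1 big1 ?addr0// => i _; rewrite expr0n mulr0.
Qed.

Lemma egf_sum (I : Type) (r : seq I) (y : I -> R) (a : I -> R^nat) t :
  (forall i, geometric_growth (a i)) ->
  egf (fun k => \sum_(i <- r) y i * a i k) t = \sum_(i <- r) y i * egf (a i) t.
Proof.
move=> ga; apply: cvg_lim => //.
elim: r => [|i r IH].
  rewrite big_nil; apply: cvg_near_cst; apply: nearW => k.
  by rewrite /pseries/= /series/= big1// => j _; rewrite big_nil !mul0r.
rewrite big_cons.
have ca : (y i \*: pseries (fun k => a i k / k`!%:R) t) x @[x --> \oo] -->
    y i * egf (a i) t.
  by apply: cvgZl_tmp; exact: is_cvg_egf.
rewrite [X in X @ _ --> _](_ : _ =
    (y i \*: pseries (fun k => a i k / k`!%:R) t) +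
    pseries (fun k => (\sum_(i <- r) y i * a i k) / k`!%:R) t).
  exact: cvgD ca IH.
apply/funext => k; rewrite /pseries/= /series/= !fctE /= scaler_sumr.
rewrite -big_split/=; apply: eq_bigr => j _; rewrite big_cons.
by rewrite /GRing.scale/= !mulrDl !mulrA.
Qed.

(** The difference vanishes on a half-line, hence so do all its right
    derivatives at [0], which are the differences of the coefficients. *)
Lemma egf_inj a b : geometric_growth a -> geometric_growth b ->
  (forall t, 0 <= t -> egf a t = egf b t) -> a =1 b.
Proof.
move=> ga gb ab k; elim: k a b ga gb ab => [|k IH] a b ga gb ab.
  by rewrite -egf0 ab// egf0.
apply: (IH (fun k => a k.+1) (fun k => b k.+1)); try exact: geometric_growthS.
move=> t t0; apply/eqP; rewrite -subr_eq0; apply/eqP.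
have [/cvg_ex[l]] := is_deriveB (is_derive_egf t ga) (is_derive_egf t gb).
move=> hl; have := hl; rewrite /derive => /(cvg_lim _) -> // lE.
rewrite -lE; have := cvg_dnbhs_at_right hl; move/(cvg_lim _) => <- //.
apply: cvg_lim => //; apply: cvg_near_cst; near=> s.
rewrite !fctE (ab t)// (ab (shift t s%:A)) ?subrr ?scaler0//.
by rewrite /shift /= addr_ge0// /GRing.scale/= mulr1.
Unshelve. all: by end_near. Qed.

End egf.

Section flow.
Context {R : realType} {n : nat}.
Implicit Types (A : 'M[R]_n) (v : 'cV[R]_n).

Lemma geometric_growth_coord A v i :
  geometric_growth (fun k => (A ^+ k *m v) i 0).
Proof.
exists (\sum_j `|v j 0|), (\sum_i \sum_j `|A i j|) => k.
elim: k i => [|k IH] i.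
  rewrite expr0 mul1mx mulr1 (bigD1 i)//= lerDl.
  exact: sumr_ge0.
rewrite exprS -mulmxA mxE (le_trans (ler_norm_sum _ _ _))//.
set q := \sum_i _ in IH *; set M := \sum_j _ in IH *.
have q0 : 0 <= q by apply: sumr_ge0 => l _; exact: sumr_ge0.
have M0 : 0 <= M by exact: sumr_ge0.
apply: (@le_trans _ _ ((\sum_j `|A i j|) * (M * q ^+ k))).
  by rewrite mulr_suml; apply: ler_sum => j _; rewrite normrM ler_wpM2l.
rewrite exprS [leRHS]mulrCA ler_wpM2r ?mulr_ge0 ?exprn_ge0//.
rewrite /q [leRHS](bigD1 i)//= lerDl; apply: sumr_ge0 => l _; exact: sumr_ge0.
Qed.

Lemma geometric_growth_mx (y : 'rV[R]_n) A v :
  geometric_growth (fun k => (y *m A ^+ k *m v) 0 0).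
Proof.
under eq_fun => k do rewrite -mulmxA mxE.
elim: (index_enum _) => [|i r [M [q IH]]].
  by exists 0, 0 => k; rewrite big_nil normr0 mul0r.
have [N [p cp]] := geometric_growth_coord A v i.
exists (`|M| + `|y 0 i| * `|N|), (`|q| + `|p|) => k; rewrite big_cons addrC.
rewrite (le_trans (ler_normD _ _))// mulrDl lerD//.
  rewrite (le_trans (IH k))// (le_trans (ler_norm _))// normrM normrX.
  by rewrite ler_wpM2l// lerXn2r ?nnegrE ?addr_ge0// lerDl.
rewrite normrM -mulrA ler_wpM2l// (le_trans (cp k))//.
rewrite (le_trans (ler_norm _))// normrM normrX.
by rewrite ler_wpM2l// lerXn2r ?nnegrE ?addr_ge0// lerDr.
Qed.

(** The solution [e^(tA) v] of [x' = A x], [x(0) = v]. *)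
Definition flow A v (t : R) : 'cV[R]_n :=
  \col_i egf (fun k => (A ^+ k *m v) i 0) t.

Lemma flow0 A v : flow A v 0 = v.
Proof. by apply/colP => i; rewrite mxE egf0 expr0 mul1mx. Qed.

Lemma mul_flow (y : 'rV[R]_n) A v t :
  (y *m flow A v t) 0 0 = egf (fun k => (y *m A ^+ k *m v) 0 0) t.
Proof.
under [in RHS]eq_fun => k do rewrite -mulmxA mxE.
rewrite (egf_sum _ (y 0)) => [|i]; last exact: geometric_growth_coord.
by rewrite mxE; apply: eq_bigr => i _; rewrite mxE.
Qed.

Lemma is_derive_flow A v i (t : R) :
  is_derive t 1 (fun t => flow A v t i 0) ((A *m flow A v t) i 0).
Proof.
under eq_fun do rewrite mxE.
have := is_derive_egf t (geometric_growth_coord A v i).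
suff -> : (A *m flow A v t) i 0 = egf (fun k => (A ^+ k.+1 *m v) i 0) t by [].
have -> : (A *m flow A v t) i 0 = (row i A *m flow A v t) 0 0.
  by rewrite -row_mul [RHS]mxE.
rewrite mul_flow; congr egf; apply/funext => k.
by rewrite exprS -2!row_mul [LHS]mxE.
Qed.

Lemma continuous_flow A v i : continuous (fun t => flow A v t i 0).
Proof.
by under eq_fun do rewrite mxE; exact/continuous_egf/geometric_growth_coord.
Qed.

End flow.

(** * The response to a pulse *)

(** Borel functions have the same integral for the Lebesgue measure on the Borel
    sigma-algebra and for its completion: the former is the image of the latter
    under the identity. *)
Lemma Rintegral_completed (R : realType) (D : set R) (g : R -> R) :
  measurable (D : set (measurableTypeR R)) ->
  measurable_fun (D : set (measurableTypeR R)) g ->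
  \int[@completed_lebesgue_measure R]_(x in D) g x =
  \int[@lebesgue_measure R]_(x in D) g x.
Proof.
move=> mD mg; rewrite /Rintegral; congr fine.
have mid : measurable_fun setT (idfun :
    caratheodory_type (wlength (@idfun R))^*%mu -> measurableTypeR R).
  by move=> _ A mA; rewrite setTI; exact: sub_caratheodory.
have main (f : R -> \bar R) : measurable_fun (D : set (measurableTypeR R)) f ->
    (forall x, 0 <= f x)%E ->
    (\int[@completed_lebesgue_measure R]_(x in D) f x =
     \int[@lebesgue_measure R]_(x in D) f x)%E.
  move=> mf f0.
  have := @ge0_integral_pushforward _ _ _ _ R _ mid
    (@completed_lebesgue_measure R) D f mD mf (fun x _ => f0 x).
  move=> /= <-.
  exact: eq_measure_integral.
rewrite integralE [RHS]integralE !main//.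
- exact/measurable_funeneg/measurable_EFinP.
- exact/measurable_funepos/measurable_EFinP.
Qed.

Lemma Rintegral_derive (R : realType) (F f : R -> R) (a b : R) :
  (forall r : R, is_derive r 1 F (f r)) -> continuous f -> a <= b ->
  \int[@lebesgue_measure R]_(r in `[a, b]) f r = F b - F a.
Proof.
move=> dF cf; rewrite le_eqVlt => /predU1P[->|ab].
  by rewrite set_itv1 Rintegral_set1 subrr.
have cF r : {for r, continuous F}.
  by apply: differentiable_continuous; apply/derivable1_diffP; have [] := dF r.
rewrite /Rintegral (@continuous_FTC2 R f F)//=.
- exact: continuous_subspaceT.
- split => [r _||]; first by have [] := dF r.
    exact: cvg_at_right_filter (cF a).
  exact: cvg_at_left_filter (cF b).
- by move=> r _; rewrite derive1E; have [_ ->] := dF r.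
Qed.

(** The integrand is [f2] plus [f1 - f2] cut off at the switching time, which
    covers both positions of [t] relative to [tau] at once. *)
Lemma Rintegral_switch (R : realType) (F1 F2 f1 f2 : R -> R) (tau t : R) :
  (forall r : R, is_derive r 1 F1 (f1 r)) -> continuous f1 ->
  (forall r : R, is_derive r 1 F2 (f2 r)) -> continuous f2 ->
  0 <= tau -> 0 <= t ->
  \int[@completed_lebesgue_measure R]_(r in `[0, t])
    (if r < tau then f1 r else f2 r) =
  F1 (Num.min t tau) - F1 0 + (F2 t - F2 (Num.min t tau)).
Proof.
move=> dF1 cf1 dF2 cf2 tau0 t0.
pose h r := f1 r - f2 r.
have ch : continuous h by move=> r; exact: cvgB (cf1 r) (cf2 r).
have dF12 (r : R) : is_derive r 1 (F1 - F2) (h r) by exact: is_deriveB.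
have int (f : R -> R) (b : R) : continuous f ->
    (@lebesgue_measure R).-integrable `[0, b] (EFin \o f).
  move=> cf; apply: continuous_compact_integrable; first exact: segment_compact.
  exact: continuous_subspaceT.
set m := Num.min t tau.
have m0 : 0 <= m by rewrite /m le_min t0.
transitivity (\int[@completed_lebesgue_measure R]_(r in `[0, t])
    (f2 r + (h \_ `]-oo, tau[) r)).
  apply: eq_Rintegral => r _; rewrite patchE mem_setE /= in_itv/= /h.
  by case: ifP => _; rewrite ?addr0// addrC subrK.
have mf2 : measurable_fun setT f2 by exact: continuous_measurable_fun.
have mh : measurable_fun setT h by exact: continuous_measurable_fun.
rewrite Rintegral_completed//; last first.
  apply: measurable_funTS; apply: measurable_funD => //.
  apply/(measurable_restrictT _ _).1 => //; exact: measurable_funTS.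
rewrite RintegralD//; last 2 first.
- exact: int.
- rewrite -[X in _.-integrable _ X]/(EFin \o (h \_ _)) -restrict_EFin.
  apply/integrable_restrict => //; apply: integrableS (int h t ch) => //.
  exact: measurableI.
rewrite -Rintegral_mkcondr (Rintegral_derive dF2)//.
have -> : \int[lebesgue_measure]_(x in `[0, t] `&` `]-oo, tau[) h x
   = \int[lebesgue_measure]_(x in `[0, m]) h x.
  rewrite /m; case: (ltP t tau) => [tt|tt].
    congr Rintegral; apply/setIidPl => r /=; rewrite !in_itv/= => /andP[_ rt].
    exact: le_lt_trans tt.
  rewrite -Rintegral_itv_bndo_bndc; last first.
    apply: integrableS (int h t ch) => // r /=; rewrite !in_itv/=.
    by move=> /andP[-> /ltW rt]; exact: le_trans tt.
  congr Rintegral; apply/seteqP; split => r /=; rewrite !in_itv/=.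
    by move=> [/andP[-> _] ->].
  by move=> /andP[-> rt]; rewrite rt (le_trans (ltW rt)).
rewrite (Rintegral_derive dF12)// !fctE.
by rewrite opprB addrACA [RHS]addrC; rewrite !addrA; lra.
Qed.

Lemma continuous_mx (R : realType) (T : topologicalType) p q
    (x : T -> 'M[R]_(p, q)) :
  (forall i j, continuous (fun t => x t i j)) -> continuous x.
Proof.
move=> cx t A [P Px PA].
have : \forall s \near t, forall i j, P i j (x s i j).
  apply: filter_forall => i; apply: filter_forall => j.
  exact: cx (Px i j).
by apply: filterS => s Ps; apply: PA.
Qed.

Lemma continuous_mulmx (R : realType) (T : topologicalType) p q r
    (M : 'M[R]_(p, q)) (x : T -> 'M[R]_(q, r)) :
  (forall i j, continuous (fun t => x t i j)) ->
  forall i j, continuous (fun t => (M *m x t) i j).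
Proof.
move=> cx i j.
have -> : (fun t => (M *m x t) i j) = (fun t => \sum_k M i k * x t k j).
  by apply/funext => t; rewrite mxE.
elim: (index_enum _) => [|k s IH].
  rewrite (_ : (fun _ => _) = cst 0); first exact: cst_continuous.
  by apply/funext => t; rewrite big_nil.
rewrite (_ : (fun _ => _) =
    fun t => M i k * x t k j + \sum_(k <- s) M i k * x t k j).
  by move=> t; apply: cvgD (IH t); apply: cvgM (cx k j t); exact: cvg_cst.
by apply/funext => t; rewrite big_cons.
Qed.

Section pulse_response.
Context {R : realType} {n : nat}.
Implicit Types (alpha tau t : R) (s : bilinear_system R n).

(** For [t <= tau] this is the on flow, for [t >= tau] the off flow started at
    time [tau]; a formula without case distinction makes continuity immediate. *)
Definition pulse_state alpha s tau t : 'cV[R]_n :=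
  let x1 := flow (sys_on alpha s) (sysb s) in
  let x2 r := flow (sysA s) (x1 tau) (r - tau) in
  x1 (Num.min t tau) + (x2 t - x2 (Num.min t tau)).

Lemma pulse_state_le alpha s tau t : t <= tau ->
  pulse_state alpha s tau t = flow (sys_on alpha s) (sysb s) t.
Proof. by move=> tt; rewrite /pulse_state min_l// subrr addr0. Qed.

Lemma pulse_state_ge alpha s tau t : tau <= t ->
  pulse_state alpha s tau t =
  flow (sysA s) (flow (sys_on alpha s) (sysb s) tau) (t - tau).
Proof.
by move=> tt; rewrite /pulse_state min_r// subrr flow0 addrC subrK.
Qed.

Lemma pulse_trajectory alpha s tau T : 0 <= tau ->
  is_trajectory s (Input T (pulse tau alpha)) (pulse_state alpha s tau).
Proof.
move=> tau0; set B := sys_on alpha s; set A := sysA s; set b := sysb s.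
pose x1 := flow B b; pose x2 r := flow A (x1 tau) (r - tau).
have cx1 i : continuous (fun t => x1 t i 0) by exact: continuous_flow.
have csub : continuous (fun r : R => r - tau).
  by move=> r; apply: cvgB; [exact: cvg_id|exact: cvg_cst].
have cx2 i : continuous (fun t => x2 t i 0).
  move=> r; apply: (@continuous_comp _ _ _ (fun r => r - tau)
    (fun t => flow A (x1 tau) t i 0)); first exact: csub.
  exact: continuous_flow.
have cM (M : 'M[R]_n) (x : R -> 'cV[R]_n) i :
    (forall i, continuous (fun t => x t i 0)) ->
    continuous (fun t => (M *m x t) i 0).
  by move=> cx; apply: continuous_mulmx => k j; rewrite ord1; exact: cx.
have cmin : continuous (fun t : R => Num.min t tau).
  move=> r; apply: (@continuous_min R _ id (cst tau)); first exact: cvg_id.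
  exact: cvg_cst.
have dx1 i (r : R) : is_derive r 1 (fun t => x1 t i 0) ((B *m x1 r) i 0).
  exact: is_derive_flow.
have dx2 i (r : R) : is_derive r 1 (fun t => x2 t i 0) ((A *m x2 r) i 0).
  have d1 : is_derive r 1 (fun r : R => r - tau) 1.
    by apply: is_derive_eq; exact: subr0.
  have := @is_derive1_comp R (fun t => flow A (x1 tau) t i 0)
    (fun r => r - tau) r _ _ (is_derive_flow A (x1 tau) i (r - tau)) d1.
  by rewrite mulr1.
have stE t i : pulse_state alpha s tau t i 0 =
    x1 (Num.min t tau) i 0 + (x2 t i 0 - x2 (Num.min t tau) i 0).
  by rewrite !mxE.
split.
  apply: continuous_subspaceT; apply: continuous_mx => i j; rewrite ord1 => r.
  under eq_fun do rewrite stE.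
  apply: cvgD; first exact: (continuous_comp (cmin r) (cx1 i _)).
  by apply: cvgB; [exact: cx2|exact: (continuous_comp (cmin r) (cx2 i _))].
move=> t /andP[t0 _] i /=.
transitivity (b i 0 + \int[@completed_lebesgue_measure R]_(r in `[0, t])
  (if r < tau then (B *m x1 r) i 0 else (A *m x2 r) i 0)); last first.
  congr (_ + _); apply: eq_Rintegral => r; rewrite inE/= in_itv/= => /andP[r0 _].
  rewrite /pulse r0/=; case: ltP => rtau.
    by rewrite pulse_state_le// ltW.
  by rewrite pulse_state_ge// scale0r addr0.
rewrite (Rintegral_switch (dx1 i) (cM B x1 i cx1) (dx2 i) (cM A x2 i cx2))//.
by rewrite stE [x1 0]flow0; ring.
Qed.

(** The outputs at time [tau + t] agree as functions of [t] for each fixed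
    [tau], hence so do their coefficients [c A^i x(tau)]; these agree as
    functions of [tau], hence so do their own coefficients. *)
Lemma pulse_parameter_eq alpha s1 s2 :
  io_equivalent_wrt (pulses alpha) s1 s2 ->
  pulse_parameter alpha s1 =2 pulse_parameter alpha s2.
Proof.
move=> s12.
have out tau t : 0 <= tau -> 0 <= t ->
    (sysc s1 *m flow (sysA s1) (flow (sys_on alpha s1) (sysb s1) tau) t) 0 0 =
    (sysc s2 *m flow (sysA s2) (flow (sys_on alpha s2) (sysb s2) tau) t) 0 0.
  move=> tau0 t0; pose u := Input (tau + t + 1) (pulse tau alpha).
  have Pu : pulses alpha u.
    by exists tau, (tau + t + 1); split => //; rewrite -addrA ltrDl ltr_wpDl.
  pose y s r := (sysc s *m pulse_state alpha s tau r) 0 0.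
  have yP s : is_output s u (y s).
    by exists (pulse_state alpha s tau) => //; exact: pulse_trajectory.
  have stE s : pulse_state alpha s tau (tau + t) =
      flow (sysA s) (flow (sys_on alpha s) (sysb s) tau) t.
    by rewrite pulse_state_ge ?lerDl// addrAC subrr add0r.
  rewrite -!stE; apply: (s12 u Pu _ _ (yP s1) (yP s2)).
  by rewrite addr_ge0//= lerDl.
move=> i j; rewrite /pulse_parameter !mulmxA.
apply: (egf_inj (geometric_growth_mx _ _ _) (geometric_growth_mx _ _ _)).
move=> tau tau0.
rewrite -!mul_flow.
apply: (egf_inj (a := fun k => (sysc s1 *m sysA s1 ^+ k *m _) 0 0)
  (geometric_growth_mx _ _ _) (geometric_growth_mx _ _ _)) => t t0.
by rewrite -!mul_flow; exact: out.
Qed.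

End pulse_response.

(** * Uniqueness of trajectories *)

Section gronwall.
Context {R : realType}.
Local Notation mu := (@completed_lebesgue_measure R).
Local Notation cR := (caratheodory_type (wlength (@idfun R))^*%mu).
Implicit Types (H t r : R) (w : R -> R).

Lemma measurable_within_continuous H t w : t <= H ->
  {within `[0, H], continuous w} ->
  measurable_fun (`[0, t] : set (measurableTypeR R)) w.
Proof.
move=> tH cw; apply: subspace_continuous_measurable_fun => //.
apply: continuous_subspaceW cw => r /=; rewrite !in_itv/= => /andP[-> rt].
exact: le_trans tH.
Qed.

Lemma measurable_cara_borel (D : set R) w :
  measurable (D : set (measurableTypeR R)) ->
  measurable_fun (D : set (measurableTypeR R)) w ->
  measurable_fun (D : set cR) w.
Proof. by move=> mD mw _ A mA; apply: sub_caratheodory; exact: mw. Qed.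

Lemma measurable_cara_itv t : measurable (`[0, t]%classic : set cR).
Proof. by apply: sub_caratheodory; exact: measurable_itv. Qed.

Lemma bounded_within_continuous H w : {within `[0, H], continuous w} ->
  exists M, forall r, 0 <= r <= H -> `|w r| <= M.
Proof.
move=> cw; have [H0|H0] := leP 0 H; last first.
  by exists 0 => r /andP[r0 rH]; have := le_trans r0 rH; rewrite leNgt H0.
have [c _ wc] := EVT_max H0 cw; have [d _ wd] := EVT_min H0 cw.
exists (`|w c| + `|w d|) => r rH; rewrite ler_norml.
have rI : r \in `[0, H] by rewrite in_itv.
have := wc r rI; have := wd r rI.
have := ler_norm (w c); have := lerNnormlW (lexx `|w d|).
have := normr_ge0 (w c); have := normr_ge0 (w d); lra.
Qed.

Lemma integrable_cara_bounded t M w :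
  measurable_fun (`[0, t]%classic : set cR) w ->
  (forall r, 0 <= r <= t -> `|w r| <= M) -> mu.-integrable `[0, t] (EFin \o w).
Proof.
move=> mw wM; apply: measurable_bounded_integrable => //.
- exact: measurable_cara_itv.
- apply: (@le_lt_trans _ _ (@lebesgue_measure R `[0, t])); first exact: lexx.
  by rewrite lebesgue_measure_itv/=; case: ifP => _; rewrite -?EFinB ltry.
- exists M; split; first exact: num_real.
  by move=> x Mx r /=; rewrite in_itv/= => /wM/le_trans; apply; exact: ltW.
Qed.

Lemma integrable_within_continuous H t w : t <= H ->
  {within `[0, H], continuous w} -> mu.-integrable `[0, t] (EFin \o w).
Proof.
move=> tH cw; have [M wM] := bounded_within_continuous cw.
apply: (@integrable_cara_bounded t M).
  by apply: measurable_cara_borel => //; exact: measurable_within_continuous cw.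
by move=> r /andP[r0 rt]; rewrite wM// r0 (le_trans rt).
Qed.

Lemma is_derive_exp_coeff (L : R) k (t : R) :
  is_derive t 1 (fun t => exp_coeff (L * t) k.+1) (L * exp_coeff (L * t) k).
Proof.
have d1 : is_derive t 1 (fun t : R => L * t) L.
  by apply: is_derive_eq; rewrite /GRing.scale/= mulr1.
have -> : (fun t => exp_coeff (L * t) k.+1) =
    (k.+1)`!%:R^-1 \*: ((fun t => L * t) ^+ k.+1).
  by apply/funext => s; rewrite /exp_coeff !fctE /= mulrC.
apply: is_derive_eq (is_deriveZ _ (is_deriveX k.+1 d1)) _.
rewrite /exp_coeff /= /GRing.scale/= factS natrM.
have : k.+1%:R != 0 :> R by rewrite pnatr_eq0.
have : k`!%:R != 0 :> R by rewrite pnatr_eq0 -lt0n fact_gt0.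
by move: (k`!%:R) (k.+1%:R) => p q p0 q0; field; rewrite p0.
Qed.

Lemma continuous_exp_coeff (L : R) k : continuous (fun t => exp_coeff (L * t) k).
Proof.
move=> t; rewrite /exp_coeff /=.
apply: cvgM; last exact: cvg_cst.
apply: (@continuous_comp _ _ _ ( *%R L) (fun t => t ^+ k)).
  exact: mulrl_continuous.
exact: exprn_continuous.
Qed.

(** Iterating the inequality gives [w t <= M (L t)^k / k!] for every [k]. *)
Lemma gronwall_eq0 H L w : 0 <= L -> {within `[0, H], continuous w} ->
  (forall t, 0 <= t <= H -> 0 <= w t <= L * \int[mu]_(r in `[0, t]) w r) ->
  forall t, 0 <= t <= H -> w t = 0.
Proof.
move=> L0 cw wL t tH; have [M wM] := bounded_within_continuous cw.
have iter k r : 0 <= r <= H -> w r <= M * exp_coeff (L * r) k.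
  elim: k r => [|k IH] r /andP[r0 rH].
    rewrite /exp_coeff/= expr0 fact0 divr1 mulr1.
    by rewrite (le_trans (ler_norm _))// wM// r0.
  have /andP[_ /le_trans] := wL r (introT andP (conj r0 rH)); apply.
  have cE : {within `[0, H], continuous (fun t => exp_coeff (L * t) k)}.
    exact: continuous_subspaceT (@continuous_exp_coeff L k).
  have iE := integrable_within_continuous rH cE.
  have -> : M * exp_coeff (L * r) k.+1 =
      L * \int[mu]_(q in `[0, r]) (M * exp_coeff (L * q) k).
    rewrite RintegralZl//; last exact: measurable_cara_itv.
    rewrite [RHS]mulrCA; congr (M * _).
    rewrite -RintegralZl//; last exact: measurable_cara_itv.
    rewrite Rintegral_completed//; last first.
      apply: (measurable_within_continuous rH); apply: continuous_subspaceT.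
      by move=> q; apply: cvgM; [exact: cvg_cst|exact: continuous_exp_coeff].
    apply: esym.
    have := @Rintegral_derive R (fun t => exp_coeff (L * t) k.+1)
      (fun t => L * exp_coeff (L * t) k) 0 r (is_derive_exp_coeff L k).
    have -> : exp_coeff (L * 0) k.+1 = 0.
      by rewrite /exp_coeff/= mulr0 expr0n mul0r.
    rewrite subr0; apply => //.
    by move=> q; apply: cvgM; [exact: cvg_cst|exact: continuous_exp_coeff].
  apply: ler_wpM2l => //; apply: le_Rintegral.
  - exact: measurable_cara_itv.
  - exact: integrable_within_continuous cw.
  - apply: integrable_within_continuous rH _; apply: continuous_subspaceT.
    by move=> q; apply: cvgM; [exact: cvg_cst|exact: continuous_exp_coeff].
  - move=> q /=; rewrite in_itv/= => /andP[q0 qr].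
    by apply: IH; rewrite q0 (le_trans qr).
apply/eqP; rewrite eq_le; apply/andP; split; last by have /andP[] := wL t tH.
rewrite -(mulr0 M).
have cM : M * exp_coeff (L * t) k @[k --> \oo] --> M * 0.
  by apply: cvgM; [exact: cvg_cst|exact: cvg_exp_coeff].
have := cvg_lim (@Rhausdorff R) cM => <-.
apply: limr_ge; first by apply/cvg_ex; exists (M * 0).
by apply: nearW => k; exact: iter.
Qed.

End gronwall.

Section uniqueness.
Context {R : realType} {n : nat}.
Local Notation mu := (@completed_lebesgue_measure R).
Local Notation cR := (caratheodory_type (wlength (@idfun R))^*%mu).
Implicit Types (H K t r : R) (v : R -> R) (x : R -> 'cV[R]_n).
Implicit Types (s : bilinear_system R n).

Lemma within_continuous_mulmx H m (P : 'M[R]_(m, n)) x i :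
  {within `[0, H], continuous x} ->
  {within `[0, H], continuous (fun t => (P *m x t) i 0)}.
Proof.
move=> cx; apply: (@continuous_mulmx R (subspace `[0, H]) _ _ _ P x) => k j t.
exact: (continuous_comp (cx t) (@coord_continuous R n 1 k j _)).
Qed.

Arguments within_continuous_mulmx {H m} P {x} i _.

Lemma vector_fieldE (P Q : 'M[R]_n) v x i r :
  ((P + v r *: Q) *m x r) i 0 = (P *m x r) i 0 + v r * (Q *m x r) i 0.
Proof. by rewrite mulmxDl -scalemxAl !mxE. Qed.

Lemma measurable_vector_field (P Q : 'M[R]_n) H v x i t : t <= H ->
  {within `[0, H], continuous x} ->
  measurable_fun (`[0, H]%classic : set cR) v ->
  measurable_fun (`[0, t]%classic : set cR)
    (fun r => ((P + v r *: Q) *m x r) i 0).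
Proof.
move=> tH cx mv.
have mM (M : 'M[R]_n) :
    measurable_fun (`[0, t]%classic : set cR) (fun r => (M *m x r) i 0).
  apply: measurable_cara_borel => //.
  exact: measurable_within_continuous tH (within_continuous_mulmx M i cx).
rewrite (_ : (fun _ => _) =
    fun r => (P *m x r) i 0 + v r * (Q *m x r) i 0); last first.
  by apply/funext => r; rewrite (vector_fieldE P Q v x).
apply: measurable_funD (mM P) _; apply: measurable_funM _ (mM Q).
apply: measurable_funS mv; first exact: measurable_cara_itv.
by move=> r /=; rewrite !in_itv/= => /andP[-> rt]; exact: le_trans tH.
Qed.

Lemma integrable_vector_field (P Q : 'M[R]_n) H K v x i t : t <= H ->
  {within `[0, H], continuous x} ->
  measurable_fun (`[0, H]%classic : set cR) v -> (forall r, `|v r| <= K) ->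
  mu.-integrable `[0, t] (EFin \o (fun r => ((P + v r *: Q) *m x r) i 0)).
Proof.
move=> tH cx mv vK.
have [M PM] := bounded_within_continuous (within_continuous_mulmx P i cx).
have [N QN] := bounded_within_continuous (within_continuous_mulmx Q i cx).
apply: (@integrable_cara_bounded _ t (M + K * N)).
  exact: measurable_vector_field cx mv.
move=> r /andP[r0 rt]; have rH : 0 <= r <= H by rewrite r0 (le_trans rt).
rewrite (vector_fieldE P Q v x) (le_trans (ler_normD _ _))// lerD ?PM// normrM.
by rewrite ler_pM ?QN.
Qed.

Arguments integrable_vector_field P Q {H K v x} i {t}.

Definition clamp K v r := Num.max (- K) (Num.min (v r) K).

Lemma clamp_le K v r : `|clamp K v r| <= `|K|.
Proof.
have K1 : K <= `|K| by exact: ler_norm.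
have K2 : - K <= `|K| by rewrite -normrN; exact: ler_norm.
have K3 : - `|K| <= - K by rewrite lerN2.
rewrite ler_norml; apply/andP; split; first by rewrite /clamp le_max K3.
by rewrite /clamp ge_max K2 ge_min K1 orbT.
Qed.

Lemma clamp_id K v r : `|v r| <= K -> clamp K v r = v r.
Proof. by rewrite ler_norml => /andP[Kv vK]; rewrite /clamp min_l// max_r. Qed.

Lemma measurable_clamp H K v : measurable_fun (`[0, H]%classic : set cR) v ->
  measurable_fun (`[0, H]%classic : set cR) (clamp K v).
Proof.
move=> mv; apply: measurable_maxr; first exact: measurable_cst.
by apply: measurable_minr mv _; exact: measurable_cst.
Qed.

(** Modifying the input on a null set does not change its trajectories, so an
    essentially bounded input may be replaced with a bounded one. *)
Lemma trajectory_clamp s H K v x :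
  measurable_fun (`[0, H]%classic : set cR) v ->
  {ae mu, forall t, 0 <= t <= H -> `|v t| <= K} ->
  is_trajectory s (Input H v) x -> is_trajectory s (Input H (clamp K v)) x.
Proof.
move=> mv vK [/= cx xE]; split; first exact: cx.
move=> t tH i; rewrite (xE t tH i); congr (_ + fine _).
have /andP[t0 tH'] := tH.
apply: ae_eq_integral.
- exact: measurable_cara_itv.
- apply/measurable_EFinP; exact: measurable_vector_field cx mv.
- apply/measurable_EFinP; apply: measurable_vector_field cx _ => //.
  exact: measurable_clamp.
- have fae : Filter (almost_everywhere mu) by exact: ae_filter_ringOfSetsType.
  apply: (@filterS _ _ fae _ _ _ vK) => r vr /=; rewrite in_itv/= => /andP[r0 rt].
  by rewrite clamp_id// vr// r0 (le_trans rt).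
Qed.

Lemma Rintegral_mulmx (P : 'M[R]_n) (g : R -> 'cV[R]_n) t i :
  (forall k, mu.-integrable `[0, t] (EFin \o (fun r => g r k 0))) ->
  \int[mu]_(r in `[0, t]) (P *m g r) i 0 =
  \sum_k P i k * \int[mu]_(r in `[0, t]) g r k 0.
Proof.
move=> ig; under eq_Rintegral do rewrite mxE.
have mt := measurable_cara_itv t.
have iPg k : mu.-integrable `[0, t] (EFin \o (fun r => P i k * g r k 0)).
  exact: (integrableZl mt (P i k) (ig k)).
elim: (index_enum _) => [|k s IH].
  under eq_Rintegral do rewrite big_nil.
  by rewrite big_nil Rintegral_cst// mul0r.
under eq_Rintegral do rewrite big_cons.
rewrite big_cons RintegralD//.
  by rewrite IH RintegralZl.
rewrite (_ : _ \o _ = fun r => (\sum_(j <- s) (P i j * g r j 0)%:E)%E).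
  apply: (@integrable_sum _ _ _ mu _ mt _ s xpredT
    (fun j r => (P i j * g r j 0)%:E)) => j _; exact: iPg.
by apply/funext => r /=; rewrite -sumEFin.
Qed.

(** Gronwall's argument applies to the l1 norm of [z]. *)
Lemma zero_trajectory s H K v (z : R -> 'cV[R]_n) :
  {within `[0, H], continuous z} ->
  measurable_fun (`[0, H]%classic : set cR) v -> (forall r, `|v r| <= K) ->
  (forall t, 0 <= t <= H -> forall i, z t i 0 =
    \int[mu]_(r in `[0, t]) ((sysA s + v r *: sysN s) *m z r) i 0) ->
  forall t, 0 <= t <= H -> z t = 0.
Proof.
move=> cz mv vK zE t tH.
have mt := @measurable_cara_itv R.
pose w r := \sum_i `|z r i 0|.
have w0 r : 0 <= w r by exact: sumr_ge0.
have cw : {within `[0, H], continuous w}.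
  (* A sum of entries is a product with the all-ones row. *)
  have -> : w = fun r => (const_mx 1 *m (\col_i `|z r i 0|) : 'M[R]_1) 0 0.
    by apply/funext => r; rewrite mxE; apply: eq_bigr => i _; rewrite !mxE mul1r.
  apply: (@continuous_mulmx R (subspace `[0, H]) _ _ _ _
    (fun r => \col_i `|z r i 0|)) => i j r.
  rewrite (_ : (fun _ => _) = (fun r => `|z r i 0|)); last first.
    by apply/funext => ?; rewrite mxE.
  apply: cvg_norm.
  exact: (continuous_comp (cz r) (@coord_continuous R n 1 i 0 _)).
have K0 : 0 <= K by exact: le_trans (vK 0).
pose q := \sum_i \sum_j (`|sysA s i j| + K * `|sysN s i j|).
have q0 : 0 <= q.
  by apply: sumr_ge0 => i _; apply: sumr_ge0 => j _; rewrite addr_ge0// mulr_ge0.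
have gq i r : `|((sysA s + v r *: sysN s) *m z r) i 0| <= q * w r.
  rewrite mxE (le_trans (ler_norm_sum _ _ _))// mulr_sumr; apply: ler_sum => j _.
  rewrite normrM ler_wpM2r// !mxE.
  rewrite (@le_trans _ _ (`|sysA s i j| + K * `|sysN s i j|))//.
    by rewrite (le_trans (ler_normD _ _))// lerD2l normrM ler_wpM2r.
  rewrite /q (bigD1 i)//= (bigD1 j)//= -addrA lerDl addr_ge0// sumr_ge0// => k _.
    by rewrite addr_ge0// mulr_ge0.
  by apply: sumr_ge0 => l _; rewrite addr_ge0// mulr_ge0.
have wt0 : w t = 0.
  apply: (@gronwall_eq0 R H (n%:R * q) w _ cw _ t tH).
    by rewrite mulr_ge0.
  move=> r rH; rewrite w0 /= -mulrA mulr_natl -[in leRHS](card_ord n) -sumr_const.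
  apply: ler_sum => i _; have /andP[_ rH'] := rH.
  have ig := integrable_vector_field (sysA s) (sysN s) i rH' cz mv vK.
  have iw := integrable_within_continuous rH' cw.
  rewrite zE// (le_trans (le_normr_Rintegral _ ig))// -RintegralZl//.
  apply: le_Rintegral => //.
  - exact: (integrable_norm ig).
  - exact: (integrableZl _ q iw).
apply/colP => i; rewrite mxE; apply/eqP; rewrite -normr_eq0.
have /eqP := wt0; rewrite psumr_eq0// => /allP/(_ i).
by rewrite mem_index_enum; apply.
Qed.

(** If [T] conjugates the first system into the second, [T x1 - x2] solves the
    second equation with initial value [0]. *)
Lemma similar_trajectory s1 s2 (T : 'M[R]_n) u x1 x2 : admissible u ->
  T *m sysA s1 = sysA s2 *m T -> T *m sysN s1 = sysN s2 *m T ->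
  T *m sysb s1 = sysb s2 ->
  is_trajectory s1 u x1 -> is_trajectory s2 u x2 ->
  forall t, 0 <= t <= horizon u -> T *m x1 t = x2 t.
Proof.
case: u => H v [/= H0 mv [K vK]] TA TN Tb tr1 tr2 t tH.
have [/= c1 x1E] := trajectory_clamp mv vK tr1.
have [/= c2 x2E] := trajectory_clamp mv vK tr2.
have mv' := measurable_clamp K mv; have vK' := clamp_le K v.
set v' := clamp K v in x1E x2E mv' vK'.
pose z r := T *m x1 r - x2 r.
apply/eqP; rewrite -subr_eq0; apply/eqP.
apply: (@zero_trajectory s2 H `|K| v' z _ mv' vK' _ t tH).
  move=> r; apply: cvgB; last exact: c2.
  apply: (@continuous_mx R (subspace `[0, H]) n 1 (fun r => T *m x1 r)) => i j.
  by rewrite ord1; exact: within_continuous_mulmx c1.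
move=> r rH i; have /andP[_ rH'] := rH.
have i1 P Q k := integrable_vector_field P Q k rH' c1 mv' vK'.
have i2 P Q k := integrable_vector_field P Q k rH' c2 mv' vK'.
have TE q : T *m ((sysA s1 + v' q *: sysN s1) *m x1 q) =
    (T *m sysA s1 + v' q *: (T *m sysN s1)) *m x1 q.
  by rewrite mulmxA mulmxDr -scalemxAr.
have zE q : ((sysA s2 + v' q *: sysN s2) *m z q) i 0 =
    (T *m ((sysA s1 + v' q *: sysN s1) *m x1 q)) i 0 -
    ((sysA s2 + v' q *: sysN s2) *m x2 q) i 0.
  by rewrite TE TA TN scalemxAl -mulmxDl -mulmxA mulmxBr !mxE.
under eq_Rintegral do rewrite zE.
rewrite RintegralB; [|exact: measurable_cara_itv| |exact: i2]; last first.
  rewrite (_ : _ \o _ = EFin \o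
    fun q => ((T *m sysA s1 + v' q *: (T *m sysN s1)) *m x1 q) i 0).
    exact: i1.
  by apply/funext => q /=; rewrite TE.
rewrite Rintegral_mulmx => [|k]; last exact: i1.
have -> : z r i 0 = (T *m x1 r) i 0 - x2 r i 0 by rewrite !mxE.
rewrite (x2E r rH) -Tb ![(T *m _) i 0]mxE.
pose I k := \int[mu]_(q in `[0, r]) ((sysA s1 + v' q *: sysN s1) *m x1 q) k 0.
have -> : \sum_k T i k * x1 r k 0 =
    \sum_k T i k * sysb s1 k 0 + \sum_k T i k * I k.
  by rewrite -big_split/=; apply: eq_bigr => k _; rewrite (x1E r rH) mulrDr.
by rewrite /I; ring.
Qed.

Lemma similar_io_equivalent s1 s2 : similar_systems s1 s2 -> io_equivalent s1 s2.
Proof.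
move=> [T [TA TN Tb cT]] u Uu y1 y2 [x1 tr1 y1E] [x2 tr2 y2E] t tu.
by rewrite y1E y2E -(similar_trajectory Uu TA TN Tb tr1 tr2 tu) mulmxA cT.
Qed.

Lemma pulses_admissible alpha : pulses alpha `<=` @admissible R.
Proof.
move=> _ [tau [T [tau0 tauT ->]]]; split => /=.
- exact: le_trans (ltW tauT).
- apply: measurable_cara_borel => //; apply: measurable_funTS.
  rewrite (_ : pulse tau alpha = fun r => alpha * \1_(`[0, tau[) r).
    by apply: measurable_funM => //; exact: measurable_indic.
  apply/funext => r; rewrite /pulse indicE mem_setE in_itv/=.
  by case: ifP => _; rewrite ?mulr1 ?mulr0.
- exists `|alpha|; apply: nearW => r _; rewrite /pulse.
  by case: ifP => // _; rewrite normr0.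
Qed.

End uniqueness.

Theorem theorem4 (R : realType) (n : nat) (n_ge1 : (1 <= n)%N)
    (alpha : R) (alpha_neq0 : alpha != 0) :
  exists M : set (bilinear_system R n),
    generic_systems M /\
    forall s1 s2 : bilinear_system R n, M s1 -> M s2 ->
      (io_equivalent_wrt (pulses alpha) s1 s2 <-> io_equivalent s1 s2).
Proof.
exists (generic_class alpha); split; first exact: generic_generic_class.
move=> s1 s2 g1 g2; split => [s12|s12 u /pulses_admissible].
  apply: similar_io_equivalent.
  exact: pulse_parameter_similar alpha_neq0 g1 g2 (pulse_parameter_eq s12).
exact: s12.
Qed.
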